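(* Let $\Gamma$ be the global monodromy group of the quintic-mirror family, i.e. the subgroup of $\mathrm{Sp}(4,\mathbb{Z})$ generated by $$A=\begin{pmatrix}11&8&-5&0\\5&-4&-3&1\\20&15&-9&0\\5&-5&-3&1\end{pmatrix},\qquad T=\begin{pmatrix}1&0&0&0\\0&1&0&-1\\0&0&1&0\\0&0&0&1\end{pmatrix}.$$ Let $$\Gamma(5,5)=\left\{X\in\mathrm{Sp}(4,\mathbb{Z})\ \middle|\ X\equiv\begin{pmatrix}1&*&*&*\\0&1&*&*\\0&0&1&0\\0&0&*&1\end{pmatrix}\ \mathrm{mod}\ 5\right\},$$ where each $*$ denotes an arbitrary entry, and let $\tilde\Gamma(5,5)$ be the set of all matrices in $\mathrm{Sp}(4,\mathbb{Z})$ of the form $$\begin{pmatrix}5x_{11}+1&x_{12}&x_{13}&x_{14}\\5x_{21}&5x_{22}+1&x_{23}&x_{24}\\5x_{31}&5x_{32}&5x_{33}+1&5x_{34}\\5x_{41}&5x_{42}&x_{43}&5x_{44}+1\end{pmatrix},\qquad x_{ij}\in\mathbb{Z}\ (1\le i,j\le 4),$$ satisfying $$x_{31}\equiv 3x_{12}\pmod 5,\qquad x_{32}\equiv 4x_{12}^2+4x_{12}\pmod 5.$$ Then: (i) $\tilde\Gamma(5,5)$ is a subgroup of $\Gamma(5,5)$. (ii) $\Gamma\subset\tilde\Gamma(5,5)\subsetneq\Gamma(5,5)$. (iii) $\tilde\Gamma(5,5)$ is a congruence subgroup of $\mathrm{Sp}(4,\mathbb{Z})$ of finite index.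
   Context: The quintic-mirror family is the one-parameter family $(W_\lambda)_{\lambda\in\mathbb{P}^1}$ obtained from the quintics $x_1^5+\cdots+x_5^5-5\psi x_1\cdots x_5=0$ in $\mathbb{P}^4$ by quotienting by the group $G\cong(\mathbb{Z}/5\mathbb{Z})^3$ of diagonal symmetries (tuples of 5th roots of unity with product 1, modulo scalars), taking a simultaneous minimal desingularization, and passing to $\lambda=\psi^5$; it is smooth over $\mathbb{P}^1-\{0,1,\infty\}$. For a fixed $b\in\mathbb{P}^1-\{0,1,\infty\}$, its global monodromy group is the image of $\pi_1(\mathbb{P}^1-\{0,1,\infty\},b)$ in $\mathrm{Aut}(H^3(W_b,\mathbb{Z}),\langle\ ,\ \rangle)$, where $\langle\ ,\ \rangle$ is the cup product form. In a suitable symplectic basis this automorphism group is identified with $\mathrm{Sp}(4,\mathbb{Z})$, the local monodromies around $\lambda=0$ and $\lambda=1$ are the matrices $A$ and $T$, and $\Gamma$ is the subgroup generated by $A$ and $T$; this concrete description is the definition of $\Gamma$ used here. $\mathrm{Sp}(4,\mathbb{Z})$ is taken with respect to the standard form with matrix $\begin{pmatrix}0&I_2\\-I_2&0\end{pmatrix}$. A congruence subgroup of $\mathrm{Sp}(4,\mathbb{Z})$ is a subgroup containing a principal congruence subgroup $\Gamma(N)=\mathrm{Ker}(\mathrm{Sp}(4,\mathbb{Z})\to\mathrm{Sp}(4,\mathbb{Z}/N\mathbb{Z}))$ for some integer $N\ge 1$. *)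

(* Defs.v *)
From HB Require Import structures.
From mathcomp Require Import all_boot all_order all_algebra.
From mathcomp Require Import classical_sets cardinality.

Set Implicit Arguments.
Unset Strict Implicit.
Unset Printing Implicit Defensive.

Import GRing.Theory.
Local Open Scope classical_set_scope.
Local Open Scope ring_scope.

Definition mx4 (rows : seq (seq int)) : 'M[int]_4 :=
  \matrix_(i < 4, j < 4) nth 0 (nth [::] rows i) j.

Definition Jmx : 'M[int]_4 :=
  (block_mx 0 1%:M (- 1%:M) 0 : 'M[int]_(2 + 2)).

Definition symplectic : pred 'M[int]_4 :=
  fun X => X^T *m Jmx *m X == Jmx.

Record Sp4Z := MkSp4Z { Sp4Z_mx :> 'M[int]_4; _ : symplectic Sp4Z_mx }.

HB.instance Definition _ := [isSub for Sp4Z_mx].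
HB.instance Definition _ := [Choice of Sp4Z by <:].

Lemma Jmx_sqr : Jmx *m Jmx = - 1%:M.
Proof.
have Jn_sqr n (Jn := block_mx 0 1%:M (- 1%:M) 0 : 'M[int]_(n + n)) :
    Jn *m Jn = - 1%:M.
  rewrite /Jn mulmx_block !mul0mx !mulmx0 mulmx1 mul1mx !addr0 !add0r.
  by rewrite scalar_mx_block opp_block_mx oppr0.
exact: (Jn_sqr 2).
Qed.

Lemma symplectic_mulVmx X : symplectic X -> - (Jmx *m X^T *m Jmx) *m X = 1%:M.
Proof.
by move/eqP=> sX; rewrite mulNmx -!mulmxA (mulmxA X^T) sX Jmx_sqr opprK.
Qed.

Lemma symplectic_unitmx X : symplectic X -> X \in unitmx.
Proof. by move/symplectic_mulVmx/mulmx1_unit=> []. Qed.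

Lemma symplectic1 : symplectic 1%:M.
Proof. by rewrite /symplectic trmx1 mul1mx mulmx1. Qed.

Lemma symplecticM X Y : symplectic X -> symplectic Y -> symplectic (X *m Y).
Proof.
move=> /eqP sX /eqP sY; apply/eqP; rewrite trmx_mul -!mulmxA.
by rewrite (mulmxA Jmx) (mulmxA X^T) (mulmxA X^T) sX mulmxA.
Qed.

Lemma symplecticV X : symplectic X -> symplectic (invmx X).
Proof.
move=> sX; have uX := symplectic_unitmx sX; apply/eqP.
rewrite -{1}(eqP sX) trmx_inv -!mulmxA mulmxV // mulmx1 mulmxA.
by rewrite mulVmx ?unitmx_tr // mul1mx.
Qed.

Definition Sp4Z_one := MkSp4Z symplectic1.
Definition Sp4Z_mul (x y : Sp4Z) := MkSp4Z (symplecticM (valP x) (valP y)).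
Definition Sp4Z_inv (x : Sp4Z) := MkSp4Z (symplecticV (valP x)).

Lemma Sp4Z_mulA : associative Sp4Z_mul.
Proof. by move=> x y z; apply: val_inj; rewrite /= mulmxA. Qed.
Lemma Sp4Z_mul1 : left_id Sp4Z_one Sp4Z_mul.
Proof. by move=> x; apply: val_inj; rewrite /= mul1mx. Qed.
Lemma Sp4Z_mulr1 : right_id Sp4Z_one Sp4Z_mul.
Proof. by move=> x; apply: val_inj; rewrite /= mulmx1. Qed.
Lemma Sp4Z_mulV : left_inverse Sp4Z_one Sp4Z_inv Sp4Z_mul.
Proof.
by move=> x; apply: val_inj; rewrite /= mulVmx // symplectic_unitmx ?(valP x).
Qed.
Lemma Sp4Z_mulrV : right_inverse Sp4Z_one Sp4Z_inv Sp4Z_mul.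
Proof.
by move=> x; apply: val_inj; rewrite /= mulmxV // symplectic_unitmx ?(valP x).
Qed.

HB.instance Definition _ := isGroup.Build Sp4Z
  Sp4Z_mulA Sp4Z_mul1 Sp4Z_mulr1 Sp4Z_mulV Sp4Z_mulrV.

(* The library's [group_closed] is about boolean predicates; membership in a
   generated subgroup of an infinite group is only a proposition. *)
Section Subgroups.
Variable G : groupType.
Implicit Types H K : set G.
Local Open Scope group_scope.

Definition is_subgroup H : Prop :=
  [/\ H 1, (forall x y, H x -> H y -> H (x * y)) & forall x, H x -> H x^-1].

Definition is_subgroup_of H K : Prop :=
  [/\ is_subgroup K, is_subgroup H & H `<=` K].

Definition generated_subgroup (S : set G) : set G := smallest is_subgroup S.

Definition left_coset H (g : G) : set G := [set g * h | h in H].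

Definition has_finite_index H : Prop := finite_set (range (left_coset H)).

End Subgroups.

Definition eqmx_mod (N : nat) (X Y : 'M[int]_4) : Prop :=
  forall i j, (X i j = Y i j %[mod N])%Z.

(* The kernel of reduction modulo N; the congruence is stated on entries because
   'Z_1 is not the trivial ring. *)
Definition principal_congruence (N : nat) : set Sp4Z :=
  [set X : Sp4Z | eqmx_mod N X 1%:M].

Definition is_congruence_subgroup (H : set Sp4Z) : Prop :=
  is_subgroup H /\
  exists N : nat, (1 <= N)%N /\ principal_congruence N `<=` H.

Definition Amx : 'M[int]_4 := mx4
  [:: [:: 11;  8; -5; 0];
      [::  5; -4; -3; 1];
      [:: 20; 15; -9; 0];
      [::  5; -5; -3; 1]].

Definition Tmx : 'M[int]_4 := mx4
  [:: [:: 1; 0; 0;  0];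
      [:: 0; 1; 0; -1];
      [:: 0; 0; 1;  0];
      [:: 0; 0; 0;  1]].

Lemma JmxE : Jmx = mx4 [:: [:: 0; 0; 1; 0]; [:: 0; 0; 0; 1];
                           [:: -1; 0; 0; 0]; [:: 0; -1; 0; 0]].
Proof.
apply/matrixP; rewrite /Jmx => i j; rewrite [RHS]mxE; move: i j.
change (forall i j : 'I_(2 + 2),
  (block_mx 0 1%:M (- 1%:M) 0 : 'M[int]_(2 + 2)) i j =
  nth 0 (nth [::] [:: [:: 0; 0; 1; 0]; [:: 0; 0; 0; 1];
                      [:: -1; 0; 0; 0]; [:: 0; -1; 0; 0]] i) j).
move=> i j; rewrite -[i]splitK -[j]splitK.
case: (split i) => -[[|[|//]] ?]; case: (split j) => -[[|[|//]] ?];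
by rewrite /= (block_mxEul, block_mxEur, block_mxEdl, block_mxEdr) !mxE.
Qed.

Lemma symplectic_Amx : symplectic Amx.
Proof.
apply/eqP/matrixP; rewrite JmxE => -[[|[|[|[|//]]]] Hi] -[[|[|[|[|//]]]] Hj];
by rewrite !(mxE, big_ord_recl, big_ord0).
Qed.

Lemma symplectic_Tmx : symplectic Tmx.
Proof.
apply/eqP/matrixP; rewrite JmxE => -[[|[|[|[|//]]]] Hi] -[[|[|[|[|//]]]] Hj];
by rewrite !(mxE, big_ord_recl, big_ord0).
Qed.

Definition monodromy_A : Sp4Z := MkSp4Z symplectic_Amx.
Definition monodromy_T : Sp4Z := MkSp4Z symplectic_Tmx.

Definition Gamma : set Sp4Z := generated_subgroup [set monodromy_A; monodromy_T].

(* In the next two sets the 0-based entry [x i j] is the informal x_(i+1)(j+1);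
   the entries of [x] that do not occur are unconstrained. *)
Definition Gamma55 : set Sp4Z :=
  [set X : Sp4Z | exists x : 'M[int]_4, eqmx_mod 5 X (mx4
    [:: [:: 1; x 0 1; x 0 2; x 0 3];
        [:: 0;     1; x 1 2; x 1 3];
        [:: 0;     0;     1;     0];
        [:: 0;     0; x 3 2;     1]])].

Definition tGamma55 : set Sp4Z :=
  [set X : Sp4Z | exists x : 'M[int]_4,
    [/\ X = mx4
          [:: [:: 5 * x 0 0 + 1;         x 0 1;         x 0 2;         x 0 3];
              [::     5 * x 1 0; 5 * x 1 1 + 1;         x 1 2;         x 1 3];
              [::     5 * x 2 0;     5 * x 2 1; 5 * x 2 2 + 1;     5 * x 2 3];
              [::     5 * x 3 0;     5 * x 3 1;         x 3 2; 5 * x 3 3 + 1]]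
          :> 'M[int]_4,
        ((x 2 0)%R = (3 * x 0 1)%R %[mod 5])%Z &
        ((x 2 1)%R = (4 * x 0 1 ^+ 2 + 4 * x 0 1)%R %[mod 5])%Z]].

(* Main.v *)
Require Import Defs.
From mathcomp Require Import all_boot all_order all_algebra.
From mathcomp Require Import classical_sets cardinality.
From mathcomp Require Import boolp ring.

(** Write [X ↦ (a, b, c)] for the residues modulo 5 of [x_12], [x_31], [x_32],
where the entries in positions (3,1) and (3,2) of a matrix of [Gamma55] are
[5 x_31] and [5 x_32]. Because [Gamma55] is unipotent modulo 5, expanding
the entries (1,2) of a product modulo 5 and (3,1), (3,2) modulo 25 gives
    [a(XY) = a(X) + a(Y)],  [b(XY) = b(X) + b(Y)],
    [c(XY) = c(X) + c(Y) + b(X) a(Y)]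
([heis_aM], [heis_bM], [heis_cM]). These are the multiplication rules of the
matrices with rows (1, b, c), (0, 1, a), (0, 0, 1), so [X ↦ (a, b, c)] is a
homomorphism from [Gamma55] to the Heisenberg group over [F_5]. The two
congruences that cut out [tGamma55] say that the image of [X] lies on the curve
[(t, 3t, 4t^2 + 4t)]. This curve is a one-parameter subgroup, since
    [4(t + u)^2 - 4t^2 - 4u^2 = 8tu = 3tu] in [F_5]
([one_parameterM], [one_parameter_cancel]); hence [tGamma55] is the preimage of
a subgroup, which is (i).

It contains both generators, by inspection of their entries, and so contains
[Gamma]. It misses the elementary symplectic matrix whose image is the point
[(0, 1, 0)] off the curve. Its defining conditions depend only on the matrix
modulo 25, so it contains the principal congruence subgroup of level 25; and a
subgroup containing the kernel of a reduction with finitely many residue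
matrices has finitely many cosets ([congruence_subgroup_finite_index]). *)

Set Implicit Arguments.
Unset Strict Implicit.
Unset Printing Implicit Defensive.

Import GRing.Theory.
Local Open Scope classical_set_scope.
Local Open Scope ring_scope.

(** * Congruence subgroups have finite index *)

Lemma eqmx_modP (N : nat) (X Y : 'M[int]_4) :
  eqmx_mod N X Y <-> forall i j, (N %| (X - Y) i j)%Z.
Proof.
split=> h i j; have := h i j; rewrite !mxE.
  by move/eqP; rewrite eqz_mod_dvd.
by move=> d; apply/eqP; rewrite eqz_mod_dvd.
Qed.

Lemma eqmx_mod_mull (N : nat) (Z X Y : 'M[int]_4) :
  eqmx_mod N X Y -> eqmx_mod N (Z *m X) (Z *m Y).
Proof.
move=> /eqmx_modP XY; apply/eqmx_modP => i j.
by rewrite -mulmxBr mxE; apply: rpred_sum => k _; apply: dvdz_mull.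
Qed.

(** Residues are kept in ['I_n.+1] rather than in ['Z_N], which is not the ring of
integers modulo [N] when [N = 1]. *)
Definition residues (n : nat) (X : Sp4Z) : 'M['I_n.+1]_4 :=
  \matrix_(i, j) inord `|(X i j %% n.+1)%Z|%N.

Lemma residues_inj (n : nat) (X Y : Sp4Z) :
  residues n X = residues n Y -> eqmx_mod n.+1 X Y.
Proof.
move=> /matrixP XY i j; have := XY i j; rewrite !mxE => /(congr1 val) /=.
have modn_ge0 (m : int) : (0 <= m %% n.+1)%Z by rewrite modz_ge0.
have bound (m : int) : (`|(m %% n.+1)%Z| < n.+1)%N.
  by rewrite -ltz_nat gez0_abs // ltz_pmod.
by rewrite !inordK // => e; rewrite -[LHS]gez0_abs // e gez0_abs.
Qed.

Lemma finite_range_factor (S : Type) (T : finType) (U : Type)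
    (f : S -> T) (g : S -> U) :
  (forall x y, f x = f y -> g x = g y) -> finite_set (range g).
Proof.
move=> fg; case: (pselect (exists x : S, True)) => [[x0 _]|noS]; last first.
  by rewrite (_ : range g = set0) // -subset0 => u [x]; case: noS; exists x.
pose h t := if pselect (exists x, f x = t) is left e
            then g (projT1 (cid e)) else g x0.
apply: (@sub_finite_set _ _ (h @` [set: T])).
  move=> _ [x _ <-]; exists (f x) => //; rewrite /h.
  case: pselect => [e|]; last by case; exists x.
  exact/fg/(projT2 (cid e)).
exact/finite_image/finite_finset.
Qed.

Local Open Scope group_scope.

Lemma left_coset_eq (G : groupType) (H : set G) (x y : G) :
  is_subgroup H -> H (x^-1 * y) -> left_coset H x = left_coset H y.
Proof.
move=> [_ HM HV] Hxy; apply/seteqP; split=> _ [h Hh <-].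
  exists ((x^-1 * y)^-1 * h); first exact/HM/Hh/HV.
  by rewrite invgM invgK !mulgA mulgV mul1g.
exists (x^-1 * y * h); first exact: HM.
by rewrite !mulgA mulgV mul1g.
Qed.

(** The coset of [X] depends only on the residues of [X]: if [X] and [Y] agree
modulo [N], then [X^-1 Y] is congruent to [X^-1 X = 1], hence lies in [H]. *)
Lemma congruence_subgroup_finite_index (H : set Sp4Z) :
  is_congruence_subgroup H -> has_finite_index H.
Proof.
move=> [sgH [[|n] [// _ subH]]].
apply: (finite_range_factor (f := residues n)) => X Y /residues_inj XY.
apply: (left_coset_eq sgH); apply: subH => i j.
have /= := @eqmx_mod_mull n.+1 (X^-1)%g Y X (fun i j => esym (XY i j)).
by move=> ->; rewrite mulVmx // symplectic_unitmx // (valP X).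
Qed.

Local Close Scope group_scope.

(** * Matrix entries and their residues modulo 5 *)

Lemma mulmx4E (X Y : 'M[int]_4) i j :
  (X *m Y) i j = X i 0 * Y 0 j + X i 1 * Y 1 j + X i 2 * Y 2 j + X i 3 * Y 3 j.
Proof.
rewrite mxE !big_ord_recl big_ord0 addr0 !addrA.
by do !congr (_ + _); congr (X _ _ * Y _ _); apply: val_inj.
Qed.

Lemma forall_ord4 (P : 'I_4 -> Prop) : P 0 -> P 1 -> P 2 -> P 3 -> forall i, P i.
Proof.
by move=> P0 P1 P2 P3 [[|[|[|[|//]]]] Hi];
  [move: P0|move: P1|move: P2|move: P3]; congr P; apply: val_inj.
Qed.

(** The symplectic relation makes [- J X^T J] the inverse of [X], so the entries
of the inverse are entries of [X] up to sign. *)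
Lemma Sp4Z_invE (X : Sp4Z) : (X^-1)%g = mx4
  [:: [::   X 2 2;    X 3 2;  - X 0 2; - X 1 2];
      [::   X 2 3;    X 3 3;  - X 0 3; - X 1 3];
      [:: - X 2 0;  - X 3 0;    X 0 0;   X 1 0];
      [:: - X 2 1;  - X 3 1;    X 0 1;   X 1 1]] :> 'M[int]_4.
Proof.
have inv_X : invmx X = - (Jmx *m X^T *m Jmx).
  have := symplectic_mulVmx (valP X); have := symplectic_unitmx (valP X).
  by move=> uX /(congr1 (mulmx^~ (invmx X))) /=; rewrite mulmxK // mul1mx.
rewrite /= inv_X; apply/matrixP.
by apply: forall_ord4; apply: forall_ord4;
  rewrite [LHS]mxE !mulmx4E JmxE !mxE /=; ring.
Qed.

Lemma eqz_mod5 (m n : int) : (m = n %[mod 5])%Z <-> m%:~R = n%:~R :> 'F_5.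
Proof.
have E : (m == n %[mod 5])%Z = (m%:~R == n%:~R :> 'F_5).
  rewrite eqz_mod_dvd (dvdz_pcharf (pchar_Fp (isT : prime 5))).
  by rewrite rmorphB subr_eq0.
by split=> /eqP; [rewrite E|rewrite -E] => /eqP.
Qed.

Lemma mod5_eq0 (m : int) : m%:~R = 0 :> 'F_5 -> m = 5 * (m %/ 5)%Z.
Proof.
move/eqP; rewrite -(dvdz_pcharf (pchar_Fp (isT : prime 5))) => /divzK e.
by rewrite mulrC e.
Qed.

(** * The group Gamma(5,5) and its map to a Heisenberg group *)

(** The shape of [Gamma55] as equations in the field ['F_5], where [ring] and
rewriting apply. Taking the basis vectors in the order 1, 2, 4, 3 turns it into
upper unitriangular shape. *)
Record unipotent_mod5 (X : 'M[int]_4) : Prop := UnipotentMod5 {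
  uni00 : (X 0 0)%:~R = 1 :> 'F_5;
  uni10 : (X 1 0)%:~R = 0 :> 'F_5;
  uni11 : (X 1 1)%:~R = 1 :> 'F_5;
  uni20 : (X 2 0)%:~R = 0 :> 'F_5;
  uni21 : (X 2 1)%:~R = 0 :> 'F_5;
  uni22 : (X 2 2)%:~R = 1 :> 'F_5;
  uni23 : (X 2 3)%:~R = 0 :> 'F_5;
  uni30 : (X 3 0)%:~R = 0 :> 'F_5;
  uni31 : (X 3 1)%:~R = 0 :> 'F_5;
  uni33 : (X 3 3)%:~R = 1 :> 'F_5 }.

(** All the known residues of [X] as one rewrite rule. *)
Definition uniE X (u : unipotent_mod5 X) :=
  (uni00 u, uni10 u, uni11 u, uni20 u, uni21 u,
   uni22 u, uni23 u, uni30 u, uni31 u, uni33 u).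

Lemma Gamma55P (X : Sp4Z) : Gamma55 X <-> unipotent_mod5 X.
Proof.
split=> [[x Xx]|u].
  have XE i j := (eqz_mod5 _ _).1 (Xx i j).
  by split; rewrite XE mxE /=.
exists X; apply: forall_ord4; apply: forall_ord4; apply/eqz_mod5;
by rewrite [in RHS]mxE /= ?uniE.
Qed.

Lemma unipotent_mod5M (X Y : 'M[int]_4) :
  unipotent_mod5 X -> unipotent_mod5 Y -> unipotent_mod5 (X *m Y).
Proof.
move=> uX uY.
by split; rewrite mulmx4E !rmorphD !rmorphM /= ?(uniE uX) ?(uniE uY); ring.
Qed.

Lemma Gamma55_subgroup : is_subgroup Gamma55.
Proof.
split=> [|X Y /Gamma55P uX /Gamma55P uY|X /Gamma55P uX]; apply/Gamma55P.
- by split; rewrite mxE.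
- exact: unipotent_mod5M.
- by split; rewrite Sp4Z_invE mxE /= ?rmorphN /= (uniE uX) ?oppr0.
Qed.

(** The coordinates of the homomorphism from [Gamma55] to the Heisenberg group;
for [X] in [Gamma55] the two divisions by 5 are exact. *)
Definition heis_a (X : 'M[int]_4) : 'F_5 := (X 0 1)%:~R.
Definition heis_b (X : 'M[int]_4) : 'F_5 := ((X 2 0)%R %/ 5)%Z%:~R.
Definition heis_c (X : 'M[int]_4) : 'F_5 := ((X 2 1)%R %/ 5)%Z%:~R.

Lemma heis_aM (X Y : 'M[int]_4) : unipotent_mod5 X -> unipotent_mod5 Y ->
  heis_a (X *m Y) = heis_a X + heis_a Y.
Proof.
move=> uX uY; rewrite /heis_a mulmx4E !rmorphD !rmorphM /=.
by rewrite !(uniE uX, uniE uY); ring.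
Qed.

(** Every term of the entry of [X Y] in question contains a factor 5, an
off-diagonal entry of the third row of [X] or the entry [Y_31]; after dividing by it, the
residues modulo 5 of the remaining factors are known. *)
Lemma heis_bM (X Y : 'M[int]_4) : unipotent_mod5 X -> unipotent_mod5 Y ->
  heis_b (X *m Y) = heis_b X + heis_b Y.
Proof.
move=> uX uY; rewrite /heis_b mulmx4E.
rewrite [in LHS](mod5_eq0 (uni20 uX)) [in LHS](mod5_eq0 (uni20 uY)).
rewrite [in LHS](mod5_eq0 (uni21 uX)) [in LHS](mod5_eq0 (uni23 uX)).
rewrite (mulrCA _ 5) -!mulrA -!mulrDr mulKz // !rmorphD !rmorphM /=.
by rewrite !(uniE uX, uniE uY); ring.
Qed.

(** Compared with [heis_bM], the product [X_31 Y_12] brings in the entry [Y_12],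
which is free modulo 5 and therefore contributes the Heisenberg cocycle. *)
Lemma heis_cM (X Y : 'M[int]_4) : unipotent_mod5 X -> unipotent_mod5 Y ->
  heis_c (X *m Y) = heis_c X + heis_c Y + heis_b X * heis_a Y.
Proof.
move=> uX uY; rewrite /heis_a /heis_b /heis_c mulmx4E.
rewrite [in LHS](mod5_eq0 (uni20 uX)) [in LHS](mod5_eq0 (uni21 uY)).
rewrite [in LHS](mod5_eq0 (uni21 uX)) [in LHS](mod5_eq0 (uni23 uX)).
rewrite (mulrCA _ 5) -!mulrA -!mulrDr mulKz // !rmorphD !rmorphM /=.
by rewrite !(uniE uX, uniE uY); ring.
Qed.

(** * The group defined by the two extra congruences *)

(** The Heisenberg coordinates of [X] are [(t, 3t, 4t^2 + 4t)] with [t = a(X)]. *)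
Definition one_parameter (X : 'M[int]_4) : Prop :=
  heis_b X = 3 * heis_a X /\ heis_c X = 4 * heis_a X ^+ 2 + 4 * heis_a X.

Lemma tGamma55P (X : Sp4Z) : tGamma55 X <-> unipotent_mod5 X /\ one_parameter X.
Proof.
have five0 : 5%:~R = 0 :> 'F_5 by apply/eqP.
split=> [[x [Xx bx cx]]|[uX [bX cX]]].
  have {}bx := (eqz_mod5 _ _).1 bx; have {}cx := (eqz_mod5 _ _).1 cx.
  split.
    by rewrite Xx; split; rewrite !mxE /= ?rmorphD ?rmorphM /= five0 mul0r ?add0r.
  rewrite /one_parameter /heis_a /heis_b /heis_c Xx !mxE /= !mulKz // bx cx.
  by rewrite !(rmorphD, rmorphM, rmorphXn).
(* The listed positions are those of the entries left free by the shape of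
   Gamma(5,5); the other entries enter through a quotient by 5. *)
pose free := [:: (0, 1); (0, 2); (0, 3); (1, 2); (1, 3); (3, 2)]%N.
exists (\matrix_(i, j) if (val i, val j) \in free then X i j
                       else ((X i j - (i == j)%:R)%R %/ 5)%Z).
have div5 (m : int) : (m%:~R = 1 :> 'F_5) -> m = 5 * ((m - 1) %/ 5)%Z + 1.
  by move=> m1; rewrite -mod5_eq0 ?subrK // rmorphB /= m1 subrr.
split.
- apply/matrixP; apply: forall_ord4; apply: forall_ord4;
  rewrite !mxE /= ?subr0 //;
  by [apply: div5; rewrite (uniE uX) | apply: mod5_eq0; rewrite (uniE uX)].
- apply/eqz_mod5; rewrite !mxE /= subr0.
  by rewrite rmorphM.
- apply/eqz_mod5; rewrite !mxE /= subr0.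
  by rewrite !(rmorphD, rmorphM, rmorphXn).
Qed.

Lemma mul5_eq0 (x : 'F_5) : 5 * x = 0.
Proof. by rewrite -[RHS](mul0r x); congr (_ * x); apply/eqP. Qed.

(** The cocycle term is [3 a(X) a(Y)], while the square contributes
[8 a(X) a(Y)]; the difference [5 a(X) a(Y)] vanishes. *)
Lemma one_parameterM (X Y : 'M[int]_4) : unipotent_mod5 X -> unipotent_mod5 Y ->
  one_parameter X -> one_parameter Y -> one_parameter (X *m Y).
Proof.
move=> uX uY [bX cX] [bY cY]; rewrite /one_parameter heis_aM // heis_bM // heis_cM //.
rewrite bX bY cX cY; split; first by ring.
by rewrite -[LHS]addr0 -(mul5_eq0 (heis_a X * heis_a Y)); ring.
Qed.

Lemma one_parameter1 : one_parameter 1%:M.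
Proof. by split; rewrite /heis_a /heis_b /heis_c !mxE /=; apply/eqP. Qed.

(** Taking [Y] to be the inverse of [X], this gives closure under inverses without
computing the coordinates of the inverse, whose entry (1,2) is the entry (4,3)
of [X]. *)
Lemma one_parameter_cancel (X Y : 'M[int]_4) : unipotent_mod5 X -> unipotent_mod5 Y ->
  one_parameter X -> one_parameter (X *m Y) -> one_parameter Y.
Proof.
move=> uX uY [bX cX].
rewrite /one_parameter heis_aM // heis_bM // heis_cM // bX cX => -[bXY cXY].
split; first by apply: (addrI (3 * heis_a X)); rewrite bXY; ring.
apply: (addrI (4 * heis_a X ^+ 2 + 4 * heis_a X)).
apply: (addIr (3 * heis_a X * heis_a Y)); rewrite cXY.
by rewrite -[RHS]addr0 -(mul5_eq0 (heis_a X * heis_a Y)); ring.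
Qed.

Lemma tGamma55_subgroup : is_subgroup tGamma55.
Proof.
have [G1 _ GV] := Gamma55_subgroup.
split=> [|X Y /tGamma55P[uX cX] /tGamma55P[uY cY]|X /tGamma55P[uX cX]].
- by apply/tGamma55P; split; [exact/Gamma55P | exact: one_parameter1].
- by apply/tGamma55P; split; [exact: unipotent_mod5M | exact: one_parameterM].
have uV : unipotent_mod5 (X^-1)%g by apply/Gamma55P/GV/Gamma55P.
apply/tGamma55P; split=> //; apply: (one_parameter_cancel uX uV cX).
rewrite [X in one_parameter X](_ : _ = 1%:M); first exact: one_parameter1.
by rewrite mulmxV // symplectic_unitmx // (valP X).
Qed.

(** Modulo 25 suffices: the coordinates [b] and [c] are residues modulo 5 of
entries already divided by 5. *)
Lemma tGamma55_congruence : is_congruence_subgroup tGamma55.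
Proof.
split; first exact: tGamma55_subgroup.
exists 25%N; split=> // X X1.
have X25 i j : exists q, X i j = 5 * (5 * q) + (i == j)%:R.
  have /dvdzP[q] := (eqmx_modP _ _ _).1 X1 i j.
  rewrite !mxE => /eqP; rewrite subr_eq => /eqP ->.
  by exists q; rewrite mulrA [RHS]addrC mulrC addrC; case: eqP.
have X5 i j : (X i j)%:~R = (i == j)%:R :> 'F_5.
  by have [q ->] := X25 i j; rewrite rmorphD rmorphM !rmorph_nat /= mul5_eq0 add0r.
apply/tGamma55P; split; first by split; rewrite X5.
have [q01 X01] := X25 0 1; have [q20 X20] := X25 2 0; have [q21 X21] := X25 2 1.
rewrite /one_parameter /heis_a /heis_b /heis_c X01 X20 X21 /= !addr0.
rewrite !mulKz // !rmorphM /= !rmorph_nat !mul5_eq0.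
by rewrite expr0n /= !mulr0 addr0.
Qed.

Lemma Gamma_sub : Gamma `<=` tGamma55.
Proof.
apply: smallest_sub; first exact: tGamma55_subgroup.
move=> X XAT; apply/tGamma55P.
case: XAT => ->; split;
  by do ?split; rewrite /heis_a /heis_b /heis_c ?mxE //=; apply/eqP.
Qed.

(** Its Heisenberg coordinates are [(0, 1, 0)]. *)
Definition Emx : 'M[int]_4 := mx4
  [:: [:: 1; 0; 0; 0];
      [:: 0; 1; 0; 0];
      [:: 5; 0; 1; 0];
      [:: 0; 0; 0; 1]].

Lemma symplectic_Emx : symplectic Emx.
Proof.
apply/eqP/matrixP; rewrite JmxE; apply: forall_ord4; apply: forall_ord4;
by rewrite !(mxE, big_ord_recl, big_ord0).
Qed.

Lemma tGamma55_proper : tGamma55 `<` Gamma55.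
Proof.
split=> [X /tGamma55P[uX _]|sub]; first exact/Gamma55P.
have /sub /tGamma55P[_ [+ _]] : Gamma55 (MkSp4Z symplectic_Emx).
  by apply/Gamma55P; split; rewrite mxE //; apply/eqP.
by rewrite /heis_a /heis_b !mxE /= => /eqP.
Qed.

Theorem mainTheorem3 :
  is_subgroup_of tGamma55 Gamma55 /\
  (Gamma `<=` tGamma55 /\ tGamma55 `<` Gamma55) /\
  (is_congruence_subgroup tGamma55 /\ has_finite_index tGamma55).
Proof.
split; first split.
- exact: Gamma55_subgroup.
- exact: tGamma55_subgroup.
- exact: properW tGamma55_proper.
split; first by split; [exact: Gamma_sub | exact: tGamma55_proper].
split; first exact: tGamma55_congruence.
exact/congruence_subgroup_finite_index/tGamma55_congruence.
Qed.
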